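(* Let $L$ be a countable relational language and let $\mu$ be an ergodic structure on $\mathrm{Str}_L$. Then $\mu$ is properly ergodic if and only if for every countable fragment $F$ of $\mathcal{L}_{\omega_1,\omega}$, there is a countable fragment $F'\supseteq F$ and a formula $\chi(\overline{x})$ in $F'$ such that $\mu(\chi(\overline{x}))>0$, but $\mu(p)=0$ for every $F'$-type $p(\overline{x})$ containing $\chi(\overline{x})$.
   Context: $\mathrm{Str}_L$ is the space of $L$-structures with domain $\mathbb{N}$, with the topology generated by the sets $\{M : M\models R(\overline{a})\}$ and $\{M: M\models\lnot R(\overline{a})\}$ ($R\in L$, $\overline a$ a tuple from $\mathbb{N}$). The logic action of $\mathrm{Sym}(\mathbb{N})$ on $\mathrm{Str}_L$ is by permuting the underlying set; its orbits are the isomorphism classes in $\mathrm{Str}_L$. A Borel probability measure $\mu$ on $\mathrm{Str}_L$ is invariant if $\mu(\sigma[X])=\mu(X)$ for all Borel $X$ and $\sigma\in\mathrm{Sym}(\mathbb{N})$. An invariant $\mu$ is ergodic if every Borel $X$ with $\mu(X\triangle\sigma[X])=0$ for all $\sigma\in \mathrm{Sym}(\mathbb{N})$ has $\mu(X)\in\{0,1\}$. An ergodic structure is an ergodic invariant probability measure on $\mathrm{Str}_L$; it is properly ergodic if it assigns measure $0$ to every orbit of the logic action. $\mathcal{L}_{\omega_1,\omega}$ extends first-order logic by conjunctions and disjunctions of countable families of formulas with a common finite set of free variables; all variables come from a fixed countable supply. A fragment is a set of $\mathcal{L}_{\omega_1,\omega}$-formulas containing all atomic formulas and closed under subformulas,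 finite Boolean combinations, quantification, and substitution of free variables. An $F$-type is a set $p(\overline{x})=\{\psi(\overline{x})\in F: M\models\psi(\overline{a})\}$ for some structure $M$ and tuple $\overline{a}$ from $M$. For an $\mathcal{L}_{\omega_1,\omega}$-formula $\varphi(\overline{x})$, $\mu(\varphi(\overline{x}))$ denotes $\mu(\{M\in\mathrm{Str}_L: M\models\varphi(\overline{a})\})$ for any tuple $\overline{a}$ of distinct elements of $\mathbb{N}$ (independent of $\overline{a}$ by invariance). For a countable fragment $F$ and an $F$-type $p(\overline{x})$, $\mu(p)$ denotes $\mu(\bigwedge_{\varphi\in p}\varphi(\overline{x}))$. *)

(* Defs.v *)
From HB Require Import structures.
From mathcomp Require Import all_boot all_order all_algebra.
From mathcomp Require Import all_classical all_reals all_analysis.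
Set Implicit Arguments.
Unset Strict Implicit.
Unset Printing Implicit Defensive.
Import Order.TTheory GRing.Theory Num.Theory.
Local Open Scope classical_set_scope.
Local Open Scope ring_scope.

Record language := Language { sym :> countType; arity : sym -> nat }.

(* [structure L D] is the type of L-structures with domain D. *)
Definition structure (L : language) (D : Type) :=
  forall P : L, (arity P).-tuple D -> Prop.

(* Formulas of L_{omega1,omega} in context: the free variables of an element
   of [iformula L n] are among x_0, ..., x_(n-1).  Hence the members of a
   countable family share a finite set of free variables.  Bound variables are
   de Bruijn indices: a quantifier binds variable 0 of its body and shifts the
   others.  [fBigAnd] and [fBigOr] take a nonempty countable family, enumerated
   with possible repetitions; the empty ones are [fTrue] and [fFalse]. *)
Inductive iformula (L : language) : nat -> Type :=
| fRel n (P : L) (t : (arity P).-tuple 'I_n) : iformula L n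
| fEq n (i j : 'I_n) : iformula L n
| fTrue n : iformula L n
| fFalse n : iformula L n
| fNot n (f : iformula L n) : iformula L n
| fAnd n (f g : iformula L n) : iformula L n
| fOr n (f g : iformula L n) : iformula L n
| fBigAnd n (f : nat -> iformula L n) : iformula L n
| fBigOr n (f : nat -> iformula L n) : iformula L n
| fEx n (f : iformula L n.+1) : iformula L n
| fAll n (f : iformula L n.+1) : iformula L n.

Arguments fEq {L n} i j.
Arguments fTrue {L} n.
Arguments fFalse {L} n.

Fixpoint sat (L : language) (D : Type) (M : structure L D) (n : nat)
    (f : iformula L n) : n.-tuple D -> Prop :=
  match f in iformula _ n return n.-tuple D -> Prop with
  | fRel _ P t => fun a => M P (map_tuple (tnth a) t)
  | fEq _ i j => fun a => tnth a i = tnth a j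
  | fTrue _ => fun=> True
  | fFalse _ => fun=> False
  | fNot _ f => fun a => ~ sat M f a
  | fAnd _ f g => fun a => sat M f a /\ sat M g a
  | fOr _ f g => fun a => sat M f a \/ sat M g a
  | fBigAnd _ f => fun a => forall k, sat M (f k) a
  | fBigOr _ f => fun a => exists k, sat M (f k) a
  | fEx _ f => fun a => exists d : D, sat M f [tuple of d :: a]
  | fAll _ f => fun a => forall d : D, sat M f [tuple of d :: a]
  end.

Definition up (n m : nat) (r : 'I_n -> 'I_m) : 'I_n.+1 -> 'I_m.+1 :=
  fun i => if unlift ord0 i is Some j then lift ord0 (r j) else ord0.

(* Substitution of x_(r i) for x_i; variables are the only terms, as the
   language is relational. *)
Fixpoint subst (L : language) (n : nat) (f : iformula L n) :
    forall m, ('I_n -> 'I_m) -> iformula L m :=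
  match f in iformula _ n return forall m, ('I_n -> 'I_m) -> iformula L m with
  | fRel _ P t => fun m r => fRel (map_tuple r t)
  | fEq _ i j => fun m r => fEq (r i) (r j)
  | fTrue _ => fun m r => fTrue m
  | fFalse _ => fun m r => fFalse m
  | fNot _ f => fun m r => fNot (subst f r)
  | fAnd _ f g => fun m r => fAnd (subst f r) (subst g r)
  | fOr _ f g => fun m r => fOr (subst f r) (subst g r)
  | fBigAnd _ f => fun m r => fBigAnd (fun k => subst (f k) r)
  | fBigOr _ f => fun m r => fBigOr (fun k => subst (f k) r)
  | fEx _ f => fun m r => fEx (subst f (up r))
  | fAll _ f => fun m r => fAll (subst f (up r))
  end.

Definition formset (L : language) := forall n, set (iformula L n).

(* Closure under subformulas is closure under immediate subformulas.  The maps r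
   in [fragment_subst] include the inclusions 'I_n -> 'I_m, so that a formula of
   the fragment belongs to it in every larger context. *)
Record fragment (L : language) (F : formset L) : Prop := {
  fragment_rel : forall n (P : L) (t : (arity P).-tuple 'I_n), F n (fRel t);
  fragment_eq : forall n (i j : 'I_n), F n (fEq i j);
  fragment_true : forall n, F n (fTrue n);
  fragment_false : forall n, F n (fFalse n);
  fragment_not : forall n (f : iformula L n), F n f -> F n (fNot f);
  fragment_and : forall n (f g : iformula L n),
    F n f -> F n g -> F n (fAnd f g);
  fragment_or : forall n (f g : iformula L n),
    F n f -> F n g -> F n (fOr f g);
  fragment_ex : forall n (f : iformula L n.+1), F n.+1 f -> F n (fEx f);
  fragment_all : forall n (f : iformula L n.+1), F n.+1 f -> F n (fAll f);
  fragment_subst : forall n m (r : 'I_n -> 'I_m) (f : iformula L n),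
    F n f -> F m (subst f r);
  fragment_sub_not : forall n (f : iformula L n), F n (fNot f) -> F n f;
  fragment_sub_and : forall n (f g : iformula L n),
    F n (fAnd f g) -> F n f /\ F n g;
  fragment_sub_or : forall n (f g : iformula L n),
    F n (fOr f g) -> F n f /\ F n g;
  fragment_sub_bigand : forall n (f : nat -> iformula L n),
    F n (fBigAnd f) -> forall k, F n (f k);
  fragment_sub_bigor : forall n (f : nat -> iformula L n),
    F n (fBigOr f) -> forall k, F n (f k);
  fragment_sub_ex : forall n (f : iformula L n.+1), F n (fEx f) -> F n.+1 f;
  fragment_sub_all : forall n (f : iformula L n.+1), F n (fAll f) -> F n.+1 f
}.

Definition countable_fragment (L : language) (F : formset L) : Prop :=
  fragment F /\ forall n, countable (F n).

Definition is_type (L : language) (F : formset L) (n : nat)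
    (p : set (iformula L n)) : Prop :=
  exists (D : Type) (M : structure L D) (a : n.-tuple D),
    inhabited D /\ p = [set f | F n f /\ sat M f a].

Definition Str (L : language) := structure L nat.

HB.instance Definition _ L := gen_eqMixin (Str L).
HB.instance Definition _ L := gen_choiceMixin (Str L).
HB.instance Definition _ L := isPointed.Build (Str L) (fun _ _ => False).

Definition str_subbase (L : language) : set (set (Str L)) :=
  [set U | exists (P : L) (a : (arity P).-tuple nat),
    U = [set M : Str L | M P a] \/ U = [set M : Str L | ~ M P a]].

HB.instance Definition _ L :=
  isSubBaseTopological.Build (Str L) (@str_subbase L) idfun.

Definition StrBorel (L : language) :=
  g_sigma_algebraType (@open (Str L)).

(* The logic action of a permutation s: the structure s M for which s is an
   isomorphism from M onto s M. *)
Definition act (L : language) (s : nat -> nat) (M : Str L) : Str L :=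
  fun P b => exists2 a, M P a & map_tuple s a = b.

Definition orbit (L : language) (M : Str L) : set (Str L) :=
  [set N | exists2 s, bijective s & N = act s M].

Section Measures.
Variables (R : realType) (L : language) (mu : probability (StrBorel L) R).
Local Open Scope ereal_scope.

Definition invariant : Prop :=
  forall s, bijective s -> forall X : set (StrBorel L), measurable X ->
    mu (act s @` X) = mu X.

Definition ergodic : Prop :=
  forall X : set (StrBorel L), measurable X ->
    (forall s, bijective s -> mu (X `+` (act s @` X)) = 0) ->
    mu X = 0 \/ mu X = 1.

Definition ergodic_structure : Prop := invariant /\ ergodic.

Definition properly_ergodic : Prop :=
  ergodic_structure /\ forall M : Str L, mu (orbit M) = 0.

(* The measure of a formula and of a type are evaluated at the tuple
   (0, ..., n-1); by invariance any other tuple of distinct elements gives the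
   same value, see [mu_formE] for formulas. *)
Definition std_tuple n : n.-tuple nat := [tuple nat_of_ord i | i < n].

Definition mu_form n (f : iformula L n) : \bar R :=
  mu [set M : Str L | sat M f (std_tuple n)].

Definition mu_type n (p : set (iformula L n)) : \bar R :=
  mu [set M : Str L | forall f, p f -> sat M f (std_tuple n)].

End Measures.

Lemma sat_subst (L : language) (D : Type) (M : structure L D) n
    (f : iformula L n) m (r : 'I_n -> 'I_m) (a : m.-tuple D) :
  sat M (subst f r) a <-> sat M f [tuple tnth a (r i) | i < n].
Proof.
have upE k l (q : 'I_k -> 'I_l) d (b : l.-tuple D) :
  [tuple tnth [tuple of d :: b] (up q i) | i < k.+1] =
  [tuple of d :: [tuple tnth b (q i) | i < k]].
  apply: eq_from_tnth => i; rewrite tnth_mktuple /up.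
  by case: unliftP => [j|] ->; rewrite ?tnth0 // !tnthS tnth_mktuple.
elim: f m r a => //= {n}.
- move=> n P t m r a; suff -> : map_tuple (tnth a) (map_tuple r t) =
    map_tuple (tnth [tuple tnth a (r i) | i < n]) t by [].
  by apply: eq_from_tnth => i; rewrite !tnth_map tnth_ord_tuple.
- by move=> n i j m r a; rewrite !tnth_mktuple.
- by move=> n f IH m r a; split=> H /IH.
- by move=> n f IHf g IHg m r a; rewrite IHf IHg.
- by move=> n f IHf g IHg m r a; rewrite IHf IHg.
- by move=> n f IH m r a; split=> H k; apply/IH.
- by move=> n f IH m r a; split=> -[k H]; exists k; apply/IH.
- by move=> n f IH m r a; split=> -[d H]; exists d;
    move: H; rewrite IH upE.
- by move=> n f IH m r a; split=> H d; move: (H d); rewrite IH upE.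
Qed.

Lemma sat_act (L : language) (s : nat -> nat) (M : Str L) n (f : iformula L n)
    (a : n.-tuple nat) : bijective s ->
  sat (act s M) f (map_tuple s a) <-> sat M f a.
Proof.
move=> bs; have [t st ts] := bs.
have consE k d (b : k.-tuple nat) :
  [tuple of d :: map_tuple s b] = map_tuple s [tuple of t d :: b].
  by apply: val_inj; rewrite /= ts.
elim: f a => //= {n}.
- move=> n P u a.
  have -> : map_tuple (tnth (map_tuple s a)) u =
      map_tuple s (map_tuple (tnth a) u).
    by apply: eq_from_tnth => i; rewrite !tnth_map.
  split; last by move=> H; exists (map_tuple (tnth a) u).
  case=> b Mb /(congr1 val) /= /(inj_map (bij_inj bs)) eb.
  by rewrite (_ : map_tuple _ _ = b) //; apply: val_inj.
- by move=> n i j a; rewrite !tnth_map; split=> [/(bij_inj bs)|->].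
- by move=> n f IH a; split=> H /IH.
- by move=> n f IHf g IHg a; rewrite IHf IHg.
- by move=> n f IHf g IHg a; rewrite IHf IHg.
- by move=> n f IH a; split=> H k; apply/IH.
- by move=> n f IH a; split=> -[k H]; exists k; apply/IH.
- move=> n f IH a; split=> -[d].
    by rewrite consE => /IH H; exists (t d).
  by move=> H; exists (s d); rewrite consE st; apply/IH.
- move=> n f IH a; split=> H d.
    by apply/IH; rewrite -(st d) -consE.
  by rewrite consE; apply/IH.
Qed.

Lemma measurable_sat (L : language) n (f : iformula L n) (a : n.-tuple nat) :
  measurable ([set M : Str L | sat M f a] : set (StrBorel L)).
Proof.
elim: f a => {n}.
- move=> n P t a; apply: sub_sigma_algebra => /=.
  exists [set [set M : Str L | M P (map_tuple (tnth a) t)]];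
    last by rewrite bigcup_set1.
  move=> _ ->; apply: finI_from1 => /=.
  by exists P, (map_tuple (tnth a) t); left.
- move=> n i j a /=; have [e|e] := pselect (tnth a i = tnth a j).
    by rewrite (_ : mkset _ = setT)//; apply/seteqP; split.
  by rewrite (_ : mkset _ = set0)//; apply/seteqP; split.
- by move=> n a; exact: measurableT.
- by move=> n a; exact: measurable0.
- by move=> n f IH a; exact: measurableC (IH a).
- by move=> n f IHf g IHg a; exact: measurableI (IHf a) (IHg a).
- by move=> n f IHf g IHg a; exact: measurableU (IHf a) (IHg a).
- move=> n f IH a.
  rewrite (_ : mkset _ = \bigcap_k [set M : Str L | sat M (f k) a]).
    by apply: bigcapT_measurable => k; exact: IH.
  by apply/seteqP; split=> M /= H k; [move=> _|]; apply: H.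
- move=> n f IH a.
  rewrite (_ : mkset _ = \bigcup_k [set M : Str L | sat M (f k) a]).
    by apply: bigcupT_measurable => k; exact: IH.
  by apply/seteqP; split=> M /=; [case=> k|case=> k _]; exists k.
- move=> n f IH a.
  rewrite (_ : mkset _ =
    \bigcup_d [set M : Str L | sat M f [tuple of d :: a]]).
    by apply: bigcupT_measurable => d; exact: IH.
  by apply/seteqP; split=> M /=; [case=> k|case=> k _]; exists k.
- move=> n f IH a.
  rewrite (_ : mkset _ =
    \bigcap_d [set M : Str L | sat M f [tuple of d :: a]]).
    by apply: bigcapT_measurable => d; exact: IH.
  by apply/seteqP; split=> M /= H k; [move=> _|]; apply: H.
Qed.

Lemma bij_extend (a b : seq nat) : uniq a -> uniq b -> size a = size b ->
  exists2 s, bijective s & map s a = b.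
Proof.
elim/last_ind: a b => [|a x IH] b.
  by move=> _ _ /esym /size0nil ->; exists id => //; exists id.
case/lastP: b => [|b y]; first by rewrite size_rcons.
rewrite !rcons_uniq !size_rcons => /andP[xa ua] /andP[yb ub] [/(IH _ ua ub)].
case=> s bs sab; pose w z := if z == s x then y else if z == y then s x else z.
have ww : involutive w.
  move=> z; rewrite /w; case: (eqVneq z (s x)) => [->|zx].
    by rewrite eqxx; case: eqVneq.
  by case: (eqVneq z y) => [->|zy]; rewrite ?eqxx ?(negbTE zx) ?(negbTE zy).
exists (w \o s); first by apply: bij_comp => //; exists w.
rewrite map_rcons /= {2}/w eqxx; congr rcons.
rewrite map_comp sab -[RHS]map_id; apply/eq_in_map => z zb; rewrite /w.
case: eqP => [zx|_]; last by case: eqP => // zy; rewrite -zy zb in yb.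
by move: zb; rewrite zx -sab (mem_map (bij_inj bs)) (negPf xa).
Qed.

Lemma mu_formE (R : realType) (L : language) (mu : probability (StrBorel L) R)
    n (f : iformula L n) (a : n.-tuple nat) :
  invariant mu -> uniq a -> mu [set M : Str L | sat M f a] = mu_form mu f.
Proof.
move=> imu ua; have ustd : uniq (std_tuple n).
  by rewrite map_inj_uniq ?enum_uniq //; exact: val_inj.
have [] := bij_extend ustd ua; first by rewrite !size_tuple.
move=> s bs sa.
have {}sa : a = map_tuple s (std_tuple n) by exact: val_inj.
rewrite /mu_form -[RHS](imu s bs) //; last exact: measurable_sat.
congr (mu _); apply/seteqP; split=> M /=; last first.
  by case=> N HN <-; rewrite sa; apply/sat_act.
have [t st ts] := bs; move=> HM.
have MN : act s (act t M) = M.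
  apply: functional_extensionality_dep => P; apply/funext => b.
  apply/propext; split.
    case=> _ [c Mc <-] <-; rewrite (_ : map_tuple _ _ = c) //.
    by apply: eq_from_tnth => i; rewrite !tnth_map ts.
  move=> Mb; exists (map_tuple t b); first by exists b.
  by apply: eq_from_tnth => i; rewrite !tnth_map ts.
exists (act t M) => //; apply/(sat_act _ _ _ bs).
by rewrite MN -sa.
Qed.

(* Main.v *)
Require Import Defs.
From mathcomp Require Import all_boot all_order all_algebra.
From mathcomp Require Import all_classical all_reals all_analysis lra.
Set Implicit Arguments.
Unset Strict Implicit.
Unset Printing Implicit Defensive.
Import Order.TTheory GRing.Theory Num.Theory.
Local Open Scope classical_set_scope.

(** An ergodic structure [mu] that is not properly ergodic lives on the
    isomorphism class of one structure [M]: this class is a Borel set by Scott's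
    theorem ([measurable_orbit]) and is invariant, so it has measure 0 or 1.  A
    countable fragment F' has only countably many types realized in [M], and
    almost surely the standard tuple realizes one of these.  Hence a formula of
    positive measure belongs to an F'-type of positive measure
    ([positive_type_of_orbit]), and the condition on fragments fails.

    Conversely, suppose that the condition fails at a fragment F: above F, every
    formula of positive measure belongs to a type of positive measure.  Then the
    algebra of n-ary formulas modulo [mu] is purely atomic.  Indeed a positive
    formula without atoms below it can be split again and again, in such a way
    that every branch of the resulting binary tree has measure 0; a countable
    fragment containing the tree has no type of positive measure containing the
    formula ([exists_atom]).  By exhaustion, countably many atoms
    cover almost all n-tuples, for each n ([exists_atomic_cover]).  An atom
    decides, almost surely, which atomic relations hold at a tuple satisfying it
    and which atoms are satisfied by extensions of this tuple.  A back-and-forth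
    argument then shows that almost all structures are isomorphic to each other
    ([determined_orbit]), so some isomorphism class has measure 1 and [mu] is
    not properly ergodic.

    Scott's theorem and the last step are the same argument: both apply
    [determined_orbit] to a notion of large set of structures that is closed
    under countable intersections, namely containing [M] and having full
    measure. *)

(** * Countable fragments *)

Lemma countable_setU (T : Type) (A B : set T) :
  countable A -> countable B -> countable (A `|` B).
Proof.
move=> cA cB; rewrite -bigcup2inE; apply: bigcup_countable => //.
by move=> [|[|]].
Qed.

Lemma countable_image (T U : Type) (f : T -> U) (A : set T) :
  countable A -> countable (f @` A).
Proof. by apply: sub_countable; apply: card_image_le. Qed.

Lemma countable_image2 (T U V : Type) (f : T -> U -> V) (A : set T)
    (B : set U) :
  countable A -> countable B -> countable [set f x y | x in A & y in B].
Proof.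
move=> cA cB; have := countable_image (uncurry f) (countableX cA cB).
apply: sub_countable; apply: subset_card_le.
by move=> _ [x Ax [y By] <-]; exists (x, y).
Qed.

Lemma image2_mem (T U V : Type) (f : T -> U -> V) (A : set T) (B : set U) x y :
  A x -> B y -> [set f x y | x in A & y in B] (f x y).
Proof. by move=> Ax By; exists x => //; exists y. Qed.

Section Fragment_generation.
Variable L : language.

(** The next five functions send a formula to its immediate subformulas, and
    take an arbitrary value on formulas of another shape: as total functions,
    they make closure under subformulas a matter of taking images. *)
Definition unneg n (f : iformula L n) : iformula L n :=
  match f in iformula _ n return iformula L n with
  | fNot _ g => g | g => g end.

Definition left_part n (f : iformula L n) : iformula L n :=
  match f in iformula _ n return iformula L n with
  | fAnd _ g _ => g | fOr _ g _ => g | g => g end.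

Definition right_part n (f : iformula L n) : iformula L n :=
  match f in iformula _ n return iformula L n with
  | fAnd _ _ g => g | fOr _ _ g => g | g => g end.

Definition family_part n (f : iformula L n) (k : nat) : iformula L n :=
  match f in iformula _ n return iformula L n with
  | fBigAnd _ g => g k | fBigOr _ g => g k | g => g end.

Definition unquantify n (f : iformula L n) : iformula L n.+1 :=
  match f in iformula _ n return iformula L n.+1 with
  | fEx _ g => g | fAll _ g => g | _ => fTrue _ end.

Definition atomics : formset L := fun n =>
  [set fRel (tagged t) | t in [set: {P : L & (arity P).-tuple 'I_n}]] `|`
  [set fEq ij.1 ij.2 | ij in [set: 'I_n * 'I_n]] `|`
  [set fTrue n] `|` [set fFalse n].

Arguments atomics n f : clear implicits.

(** One round of all the closure conditions of a fragment.  Substitutions are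
    taken along finite functions, of which there are countably many. *)
Definition consequences (S : formset L) : formset L := fun n =>
  S n `|` atomics n `|`
  (@fNot L n @` S n) `|` (@unneg n @` S n) `|`
  [set fAnd f g | f in S n & g in S n] `|`
  [set fOr f g | f in S n & g in S n] `|`
  (@left_part n @` S n) `|` (@right_part n @` S n) `|`
  [set family_part f k | f in S n & k in [set: nat]] `|`
  (@fEx L n @` S n.+1) `|` (@fAll L n @` S n.+1) `|`
  (if n is m.+1 then @unquantify m @` S m else set0) `|`
  \bigcup_(m in [set: nat])
    [set subst f (fun i => r i) | f in S m & r in [set: {ffun 'I_m -> 'I_n}]].

Arguments consequences S n f : clear implicits.

Lemma countable_consequences (S : formset L) :
  (forall n, countable (S n)) -> forall n, countable (consequences S n).
Proof.
move=> cS n; rewrite /consequences /atomics.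
repeat apply: countable_setU; try by [apply: countable_image|apply: countable1
 |apply: countable_image2|apply/countable_image/countableP
 |apply: countable_image2 => //; apply: countableP].
- exact: cS.
- by case: n => // m; apply: countable_image.
- apply: bigcup_countable => // m _.
  by apply: countable_image2 => //; exact: countableP.
Qed.

Ltac in_union :=
  solve [repeat (first [assumption | right; assumption | left])].

(** Every closure condition has finitely many premises, so countably many
    rounds of [consequences] reach a fragment. *)
Lemma exists_countable_fragment (S : formset L) :
  (forall n, countable (S n)) ->
  exists F : formset L, countable_fragment F /\ forall n, S n `<=` F n.
Proof.
move=> cS; pose T k := iter k consequences S.
have T_S k n f : T k n f -> T k.+1 n f by rewrite /T iterS => Tf; in_union.
have T_le k l n f : k <= l -> T k n f -> T l n f.
  by move=> /subnK <-; elim: (l - k)%N => // j IH /IH; apply: T_S.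
pose F n := \bigcup_k T k n.
have TC k n f : consequences (T k) n f -> F n f by move=> Tf; exists k.+1.
have atomF n f : atomics n f -> F n f by move=> ?; apply: (TC 0); in_union.
exists F; split; last by move=> n f Sf; exists 0.
split; last first.
  move=> n; apply: bigcup_countable => // k _; elim: k n => // k IH n.
  exact: countable_consequences.
split.
- by move=> n P t; apply: atomF; left; left; left; exists (existT _ P t).
- by move=> n i j; apply: atomF; left; left; right; exists (i, j).
- by move=> n; apply: atomF; left; right.
- by move=> n; apply: atomF; right.
- move=> n f [k _ Tf]; apply: (TC k); have := imageP (@fNot L n) Tf.
  by move=> ?; in_union.
- move=> n f g [k _ Tf] [l _ Tg]; apply: (TC (maxn k l)).
  have := image2_mem (@fAnd L n) (T_le _ _ _ _ (leq_maxl k l) Tf)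
    (T_le _ _ _ _ (leq_maxr k l) Tg).
  by move=> ?; in_union.
- move=> n f g [k _ Tf] [l _ Tg]; apply: (TC (maxn k l)).
  have := image2_mem (@fOr L n) (T_le _ _ _ _ (leq_maxl k l) Tf)
    (T_le _ _ _ _ (leq_maxr k l) Tg).
  by move=> ?; in_union.
- move=> n f [k _ Tf]; apply: (TC k); have := imageP (@fEx L n) Tf.
  by move=> ?; in_union.
- move=> n f [k _ Tf]; apply: (TC k); have := imageP (@fAll L n) Tf.
  by move=> ?; in_union.
- move=> n m r f [k _ Tf]; apply: (TC k).
  suff: (\bigcup_(m in [set: nat]) [set subst f (fun i => r i) |
    f in T k m & r in [set: {ffun 'I_m -> _}]]) (subst f r).
    by move=> ?; in_union.
  exists n => //; exists f => //; exists (finfun r) => //.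
  by congr subst; apply/funext => i; rewrite ffunE.
- move=> n f [k _ Tf]; apply: (TC k); have := imageP (@unneg n) Tf.
  by move=> ?; in_union.
- move=> n f g [k _ Tf]; have := imageP (@left_part n) Tf.
  have := imageP (@right_part n) Tf; move=> ? ?.
  by split; apply: (TC k); in_union.
- move=> n f g [k _ Tf]; have := imageP (@left_part n) Tf.
  have := imageP (@right_part n) Tf; move=> ? ?.
  by split; apply: (TC k); in_union.
- move=> n f [k _ Tf] j; apply: (TC k).
  have := image2_mem (@family_part n) Tf (I : [set: nat] j).
  by move=> ?; in_union.
- move=> n f [k _ Tf] j; apply: (TC k).
  have := image2_mem (@family_part n) Tf (I : [set: nat] j).
  by move=> ?; in_union.
- move=> n f [k _ Tf]; apply: (TC k); have := imageP (@unquantify n) Tf.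
  by move=> ?; in_union.
- move=> n f [k _ Tf]; apply: (TC k); have := imageP (@unquantify n) Tf.
  by move=> ?; in_union.
Qed.

End Fragment_generation.

(** * Back-and-forth on the natural numbers *)

Lemma uniq_unzip1_inj (S T : eqType) (w : seq (S * T)) x y y' :
  uniq (unzip1 w) -> (x, y) \in w -> (x, y') \in w -> y = y'.
Proof.
elim: w => // -[s t] w IH /= /andP[sw uw]; rewrite !inE !xpair_eqE.
have notw z : (s, z) \in w -> False by move/(map_f fst) => /=; apply/negP.
case: (eqVneq x s) => [->|_] /=; last exact: IH.
by move=> /orP[/eqP->|/notw//] /orP[/eqP->|/notw//].
Qed.

Lemma uniq_unzip2_inj (S T : eqType) (w : seq (S * T)) x x' y :
  uniq (unzip2 w) -> (x, y) \in w -> (x', y) \in w -> x = x'.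
Proof.
elim: w => // -[s t] w IH /= /andP[tw uw]; rewrite !inE !xpair_eqE.
have notw z : (z, t) \in w -> False by move/(map_f snd) => /=; apply/negP.
case: (eqVneq y t) => [->|_] /=; rewrite ?andbT ?andbF; last exact: IH.
by move=> /orP[/eqP->|/notw//] /orP[/eqP->|/notw//].
Qed.

(** The two requirements are met alternately: stage [m.+1] puts [m] into both
    the domain and the range of stage [m].  The union of the stages is the graph
    of a bijection. *)
Lemma back_and_forth (P : seq (nat * nat) -> Prop) :
  P [::] ->
  (forall w, P w -> uniq (unzip1 w) /\ uniq (unzip2 w)) ->
  (forall w x, P w ->
    exists w', [/\ P w', {subset w <= w'} & x \in unzip1 w']) ->
  (forall w y, P w ->
    exists w', [/\ P w', {subset w <= w'} & y \in unzip2 w']) ->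
  exists2 s, bijective s & forall u : seq nat, exists w,
    [/\ P w, {subset u <= unzip1 w} & {in w, forall z, z.2 = s z.1}].
Proof.
move=> P0 Puniq forth back.
have next (mw : nat * seq (nat * nat)) : exists w', P mw.2 ->
    [/\ P w', {subset mw.2 <= w'}, mw.1 \in unzip1 w' & mw.1 \in unzip2 w'].
  have [Pw|nPw] := pselect (P mw.2); last by exists [::].
  have [w1 [Pw1 sw1 m1]] := forth _ mw.1 Pw.
  have [w2 [Pw2 sw2 m2]] := back _ mw.1 Pw1.
  exists w2 => _; split=> // [z /sw1/sw2//|].
  by have /mapP[z zw1 ->] := m1; apply/map_f/sw2.
have [g gP] := choice next.
pose W := fix W m := if m is k.+1 then g (k, W k) else [::].
have PW m : P (W m) by elim: m => //= m IH; have [] := gP (m, W m) IH.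
have W_S m : {subset W m <= W m.+1} by have [] := gP (m, W m) (PW m).
have W_le m n : m <= n -> {subset W m <= W n}.
  by move=> /subnK<-; elim: (n - m)%N => // k IH z /IH; apply: W_S.
have ex_s x : exists y, (x, y) \in W x.+1.
  have [_ _ /mapP[[x' y] xyW /= xx'] _] := gP (x, W x) (PW x).
  by exists y; rewrite {1}xx'.
have ex_t y : exists x, (x, y) \in W y.+1.
  have [_ _ _ /mapP[[x y'] xyW /= yy']] := gP (y, W y) (PW y).
  by exists x; rewrite {1}yy'.
have [s sP] := choice ex_s; have [t tP] := choice ex_t.
have Ws m x y : (x, y) \in W m -> y = s x.
  move=> xy; have [u1 _] := Puniq _ (PW (maxn m x.+1)).
  apply: (uniq_unzip1_inj u1); first exact: W_le (leq_maxl _ _) _ xy.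
  exact: W_le (leq_maxr _ _) _ (sP x).
have Wt m x y : (x, y) \in W m -> x = t y.
  move=> xy; have [_ u2] := Puniq _ (PW (maxn m y.+1)).
  apply: (uniq_unzip2_inj u2); first exact: W_le (leq_maxl _ _) _ xy.
  exact: W_le (leq_maxr _ _) _ (tP y).
exists s.
  by exists t => [x|y]; [rewrite -(Wt _ _ _ (sP x))|rewrite -(Ws _ _ _ (tP y))].
move=> u; exists (W (\max_(x <- u) x.+1)); split=> // [x xu|[x y] /Ws//].
have xm : x.+1 <= \max_(x <- u) x.+1.
  by rewrite (big_rem x) //= leq_max ltnSn.
exact: (map_f fst (W_le _ _ xm _ (sP x))).
Qed.

(** * Families of complete formulas that determine the isomorphism type *)

Section Back_and_forth_systems.
Variable L : language.

Lemma act_comp (s t : nat -> nat) (M : Str L) :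
  act s (act t M) = act (s \o t) M.
Proof.
apply: functional_extensionality_dep => P; apply/funext => b; apply/propext.
split.
  move=> [_ [c Mc <-] <-]; exists c => //.
  by apply: val_inj; rewrite /= map_comp.
move=> [c Mc <-]; exists (map_tuple t c); first by exists c.
by apply: val_inj; rewrite /= map_comp.
Qed.

Lemma act_id (M : Str L) : act id M = M.
Proof.
apply: functional_extensionality_dep => P; apply/funext => b; apply/propext.
split.
  move=> [c Mc <-]; rewrite (_ : map_tuple _ _ = c) //.
  by apply: val_inj; rewrite /= map_id.
by move=> Mb; exists b => //; apply: val_inj; rewrite /= map_id.
Qed.

Lemma act_cancel (s t : nat -> nat) (M : Str L) :
  cancel t s -> act s (act t M) = M.
Proof.
by move=> ts; rewrite act_comp (_ : s \o t = id) ?act_id//; apply/funext.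
Qed.

Definition fresh n : iformula L n.+1 :=
  foldr (fun i f => fAnd (fNot (fEq ord0 (lift ord0 i))) f) (fTrue n.+1)
    (enum 'I_n).

Lemma sat_fresh D (M : structure L D) n d (a : n.-tuple D) :
  sat M (fresh n) [tuple of d :: a] <-> forall i, d <> tnth a i.
Proof.
suff E (s : seq 'I_n) : sat M (foldr (fun i f =>
    fAnd (fNot (fEq ord0 (lift ord0 i))) f) (fTrue n.+1) s) [tuple of d :: a]
    <-> forall i, i \in s -> d <> tnth a i.
  by rewrite /fresh E; split=> H i => [|_]; apply: H; rewrite mem_enum.
elim: s => [|i s IH] /=; first by split.
rewrite IH tnth0 tnthS; split=> [[di H] j|H].
  by rewrite inE => /orP[/eqP->|/H].
by split=> [|j js]; apply: H; rewrite inE ?eqxx ?js ?orbT.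
Qed.

(** The questions that a back-and-forth argument asks about an n-tuple: which
    atomic relations it satisfies, and by which of the formulas [A n.+1 l] it
    can be extended by a new element. *)
Definition probe_index n := ({P : L & (arity P).-tuple 'I_n} + nat)%type.

Definition probe (A : forall n, nat -> iformula L n) n (i : probe_index n) :
    iformula L n :=
  match i with
  | inl t => fRel (tagged t)
  | inr l => fEx (fAnd (fresh n) (A n.+1 l))
  end.

(** The structures in which each tuple of distinct elements satisfies some
    formula of the family [A], and in which the answers to the questions of
    [probe] depend on that formula only, as prescribed by the table [e].  The
    table [e0] settles the empty tuple, where the back-and-forth starts. *)
Definition obeys (A : forall n, nat -> iformula L n) (e0 : nat -> Prop)
    (e : forall n, nat -> probe_index n -> Prop) : set (Str L) :=
  [set N | (forall k, sat N (A 0 k) [tuple] <-> e0 k) /\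
    forall n (a : n.-tuple nat), uniq a ->
      (exists k, sat N (A n k) a) /\
      forall k i, sat N (A n k) a -> sat N (probe A i) a <-> e n k i].

Lemma measurable_forall (T : countType) (P : T -> set (StrBorel L)) :
  (forall t, measurable (P t)) ->
  measurable ([set N | forall t, P t N] : set (StrBorel L)).
Proof.
move=> mP; rewrite (_ : mkset _ = \bigcap_(k : nat)
    (if unpickle k is Some t then P t else setT)).
  by apply: bigcapT_measurable => k; case: (unpickle k).
apply/seteqP; split=> N H; first by move=> k _ /=; case: (unpickle k).
by move=> t; have := H (pickle t) I; rewrite pickleK.
Qed.

Lemma measurable_exists (T : countType) (P : T -> set (StrBorel L)) :
  (forall t, measurable (P t)) ->
  measurable ([set N | exists t, P t N] : set (StrBorel L)).
Proof.
move=> mP; rewrite (_ : mkset _ = ~` [set N | forall t, (~` P t) N]).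
  apply: measurableC; apply: measurable_forall => t.
  exact: measurableC (mP t).
apply/seteqP; split=> N; first by move=> [t Pt] /(_ t).
by move=> /existsNP[t /contrapT Pt]; exists t.
Qed.

Lemma measurable_iff_cst (P : set (StrBorel L)) (Q : Prop) :
  measurable P -> measurable ([set N | P N <-> Q] : set (StrBorel L)).
Proof.
move=> mP; have [q|nq] := pselect Q.
  by rewrite (_ : mkset _ = P) //; apply/seteqP; split=> N /=; tauto.
rewrite (_ : mkset _ = ~` P); first exact: measurableC.
by apply/seteqP; split=> N /=; tauto.
Qed.

Lemma measurable_imply (P Q : set (StrBorel L)) :
  measurable P -> measurable Q ->
  measurable ([set N | P N -> Q N] : set (StrBorel L)).
Proof.
move=> mP mQ; rewrite (_ : mkset _ = ~` P `|` Q).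
  by apply: measurableU => //; apply: measurableC.
apply/seteqP; split=> N /=; last by tauto.
by have := pselect (P N); tauto.
Qed.

Lemma measurable_obeys A e0 e : measurable (@obeys A e0 e : set (StrBorel L)).
Proof.
apply: measurableI.
  apply: measurable_forall => k; apply: measurable_iff_cst.
  exact: measurable_sat.
apply: measurable_forall => n; apply: measurable_forall => a.
have [ua|nua] := pselect (uniq a); last first.
  by rewrite [X in measurable X](_ : _ = setT)//; apply/seteqP; split.
rewrite [X in measurable X](_ : _ = [set N | exists k, sat N (A n k) a] `&`
  [set N | forall k i, sat N (A n k) a -> sat N (probe A i) a <-> e n k i]).
  apply: measurableI.
    by apply: measurable_exists => k; apply: measurable_sat.
  apply: measurable_forall => k; apply: measurable_forall => i.
  apply: measurable_imply; first exact: measurable_sat.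
  by apply: measurable_iff_cst; apply: measurable_sat.
by apply/seteqP; split=> N /=; tauto.
Qed.

Lemma obeys_act A e0 e s (M : Str L) :
  bijective s -> @obeys A e0 e M -> obeys A e0 e (act s M).
Proof.
move=> bs [M0 MA]; split=> [k|n a ua].
  have := @sat_act _ s M _ (A 0 k) [tuple] bs.
  by rewrite (tuple0 (map_tuple s _)) => ->.
have [t st ts] := bs; pose b := map_tuple t a.
have ab : a = map_tuple s b.
  by apply: val_inj; rewrite /= -map_comp -[LHS]map_id; apply: eq_map => x /=.
have ub : uniq b by rewrite map_inj_uniq//; apply: can_inj ts.
have [[k Mk] Mi] := MA n b ub; rewrite ab.
split; first by exists k; apply/sat_act.
by move=> j i; rewrite !sat_act //; apply: Mi.
Qed.

(** Matching tuples that satisfy a common member of [A] form a back-and-forth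
    system: an extension of one tuple satisfies some [A n.+1 l], and the table
    says that the other tuple then has an extension satisfying [A n.+1 l]
    too. *)
Lemma obeys_iso A e0 e (M N : Str L) :
  @obeys A e0 e M -> obeys A e0 e N -> Defs.orbit M N.
Proof.
move=> oM oN; have [M0 MA] := oM; have [N0 NA] := oN.
(* Listing the matched pairs keeps the two tuples at the same length, hence
   under the same formulas. *)
pose P (w : seq (nat * nat)) :=
  [/\ uniq (unzip1 w), uniq (unzip2 w) & exists k,
   sat M (A _ k) (map_tuple fst (in_tuple w)) /\
   sat N (A _ k) (map_tuple snd (in_tuple w))].
have [|w []//|w x [u1 u2 [k [Mk Nk]]]|w y [u1 u2 [k [Mk Nk]]]|s bs sP] :=
    @back_and_forth P.
- split=> //; have [[k Mk] _] := MA 0 [tuple] isT.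
  exists k; move: (Mk); rewrite M0 -N0.
  by rewrite !(tuple0 (map_tuple _ _)).
- have [xw|xw] := boolP (x \in unzip1 w).
    by exists w; split=> //; split=> //; exists k.
  have ux : uniq [tuple of x :: map_tuple fst (in_tuple w)] by rewrite /= xw.
  have [[l Ml] _] := MA _ _ ux.
  have : sat M (probe A (inr l)) (map_tuple fst (in_tuple w)).
    exists x; split=> //; apply/sat_fresh => i xi; move/negP: xw; apply.
    by rewrite xi; apply: mem_tnth.
  have [_ /(_ k (inr l) Mk) ->] := MA _ (map_tuple fst (in_tuple w)) u1.
  have [_ /(_ k (inr l) Nk) <-] := NA _ (map_tuple snd (in_tuple w)) u2.
  move=> [y [/sat_fresh yw Nl]]; exists ((x, y) :: w).
  split; last by rewrite /= mem_head.
    split; first by rewrite /= xw.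
      rewrite /= u2 andbT; apply/negP => yw'.
      have /tnthP[i yi] : y \in map_tuple snd (in_tuple w) by [].
      exact: (yw i).
    exists l; split; [move: Ml|move: Nl]; congr sat; exact: val_inj.
  by move=> z zw; rewrite inE zw orbT.
- have [yw|yw] := boolP (y \in unzip2 w).
    by exists w; split=> //; split=> //; exists k.
  have uy : uniq [tuple of y :: map_tuple snd (in_tuple w)] by rewrite /= yw.
  have [[l Nl] _] := NA _ _ uy.
  have : sat N (probe A (inr l)) (map_tuple snd (in_tuple w)).
    exists y; split=> //; apply/sat_fresh => i yi; move/negP: yw; apply.
    by rewrite yi; apply: mem_tnth.
  have [_ /(_ k (inr l) Nk) ->] := NA _ (map_tuple snd (in_tuple w)) u2.
  have [_ /(_ k (inr l) Mk) <-] := MA _ (map_tuple fst (in_tuple w)) u1.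
  move=> [x [/sat_fresh xw Ml]]; exists ((x, y) :: w).
  split; last by rewrite /= mem_head.
    split; last 1 first.
    + exists l; split; [move: Ml|move: Nl]; congr sat; exact: val_inj.
    + rewrite /= u1 andbT; apply/negP => xw'.
      have /tnthP[i xi] : x \in map_tuple fst (in_tuple w) by [].
      exact: (xw i).
    + by rewrite /= yw.
  by move=> z zw; rewrite inE zw orbT.
have rel Q (c : (arity Q).-tuple nat) : M Q c <-> N Q (map_tuple s c).
  have [w [[u1 u2 [k [Mk Nk]]] cw wE]] := sP c.
  have ex_t (i : 'I_(arity Q)) : exists j,
      tnth c i = tnth (map_tuple fst (in_tuple w)) j.
    by have /cw/(@tnthP _ _ (map_tuple fst (in_tuple w))) := mem_tnth i c.
  have [t tP] := choice ex_t; pose u := [tuple t i | i < arity Q].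
  have uE i : tnth u i = t i by rewrite tnth_mktuple.
  have cE : c = map_tuple (tnth (map_tuple fst (in_tuple w))) u.
    apply: eq_from_tnth => i; rewrite [RHS]tnth_map uE; exact: tP.
  have scE : map_tuple s c = map_tuple (tnth (map_tuple snd (in_tuple w))) u.
    apply: eq_from_tnth => i.
    rewrite [RHS]tnth_map uE [LHS]tnth_map tP !tnth_map.
    by rewrite wE // mem_tnth.
  have [_ /(_ k (inl (Tagged _ u)) Mk) /= HM] :=
    MA _ (map_tuple fst (in_tuple w)) u1.
  have [_ /(_ k (inl (Tagged _ u)) Nk) /= HN] :=
    NA _ (map_tuple snd (in_tuple w)) u2.
  by rewrite scE {1}cE HM HN.
exists s => //.
have [t st ts] := bs.
apply: functional_extensionality_dep => Q; apply/funext => b; apply/propext.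
have bE : b = map_tuple s (map_tuple t b).
  by apply: eq_from_tnth => i; rewrite !tnth_map ts.
split=> [Nb|[c Mc <-]]; last exact/rel.
by exists (map_tuple t b) => //; apply/rel; rewrite -bE.
Qed.

(** [psi] is complete modulo [FF], a family of large sets of structures. *)
Definition determined (FF : set (set (Str L))) n (psi : iformula L n) :=
  forall theta : iformula L n,
  FF [set N | forall a : n.-tuple nat,
    uniq a -> sat N psi a -> sat N theta a] \/
  FF [set N | forall a : n.-tuple nat,
    uniq a -> sat N psi a -> ~ sat N theta a].

(** If large sets are closed under supersets and countable intersections, if
    a large set of structures has all its tuples of distinct elements covered by
    the complete formulas [A n k], and if every sentence is decided, then each
    question gets the same answer at all tuples satisfying [A n k], in a large
    set of structures.  This gives a table obeyed by a large set of structures,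
    and that set is an isomorphism class.  It is used twice: with the sets
    containing a fixed structure, and with the sets of full measure. *)
Lemma determined_orbit (FF : set (set (Str L)))
    (A : forall n, nat -> iformula L n) :
  (forall X Y, X `<=` Y -> FF X -> FF Y) ->
  (forall (T : countType) (X : T -> set (Str L)),
     (forall t, FF (X t)) -> FF [set N | forall t, X t N]) ->
  (forall n k, determined FF (A n k)) -> determined FF (fTrue 0) ->
  (forall n, FF [set N | forall a : n.-tuple nat,
     uniq a -> exists k, sat N (A n k) a]) ->
  exists G : set (Str L), [/\ measurable (G : set (StrBorel L)), FF G &
    forall M, G M -> G = Defs.orbit M].
Proof.
move=> FFS FFI detA det0 cov.
pose e0 k := FF [set N | sat N (A 0 k) [tuple]].
pose e n k (i : probe_index n) := FF [set N | forall a : n.-tuple nat,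
  uniq a -> sat N (A n k) a -> sat N (probe A i) a].
have FF2 X Y : FF X -> FF Y -> FF (X `&` Y).
  move=> FX FY; apply: (FFS [set N | forall b : bool, (if b then X else Y) N]).
    by move=> N H; split; [apply: (H true)|apply: (H false)].
  by apply: (FFI); case.
exists (obeys A e0 e); split; first exact: measurable_obeys.
  apply: (FF2).
    apply: (FFI) => k; have [H|H] := det0 (A 0 k).
      have e0k : e0 k by apply: (FFS) H => N /=; apply.
      by apply: (FFS) (e0k) => N /= Ns; split.
    have [e0k|ne] := pselect (e0 k).
      by apply: (FFS) (e0k) => N /= Ns; split.
    by apply: (FFS) H => N /= /(_ [tuple] isT I) nN; split.
  apply: (FFS [set N | forall n,
    (forall a : n.-tuple nat, uniq a -> exists k, sat N (A n k) a) /\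
    forall k i (a : n.-tuple nat), uniq a ->
      sat N (A n k) a -> sat N (probe A i) a <-> e n k i]).
    move=> N H n a ua; have [H1 H2] := H n.
    by split=> [|k i]; [apply: H1|apply: H2].
  apply: (FFI) => n; apply: (FF2); first exact: cov.
  apply: (FFI) => k; apply: (FFI) => i.
  have [ei|nei] := pselect (e n k i).
    by apply: (FFS) (ei) => N H a ua Aa; split=> // _; apply: H.
  case: (detA n k (probe A i)) => // H; apply: (FFS) H => N H a ua Aa.
  by split=> // /(H a ua Aa).
move=> M oM; apply/seteqP; split=> N; first exact: obeys_iso.
by move=> [s bs ->]; apply: obeys_act.
Qed.

(** Scott's theorem.  For each pair of tuples of [M] that some formula
    separates, choose a separating formula; the conjunction of those chosen for
    a given first tuple is complete in [M], because it holds only at the tuples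
    that satisfy the same formulas.  The large sets here are those containing
    [M]. *)
Lemma measurable_orbit (M : Str L) :
  measurable (Defs.orbit M : set (StrBorel L)).
Proof.
have sep n (ab : n.-tuple nat * n.-tuple nat) : exists chi : iformula L n,
    sat M chi ab.1 /\
    ((exists f, sat M f ab.1 /\ ~ sat M f ab.2) -> ~ sat M chi ab.2).
  have [[f [f1 f2]]|H] := pselect (exists f, sat M f ab.1 /\ ~ sat M f ab.2).
    by exists f.
  by exists (fTrue n); split.
pose tup n k : n.-tuple nat := odflt (nseq_tuple n 0) (unpickle k).
have tupK n (a : n.-tuple nat) : exists k, tup n k = a.
  by exists (pickle a); rewrite /tup pickleK.
pose A n k := fBigAnd (fun j => sval (cid (sep n (tup n k, tup n j)))).
have AP n k (a : n.-tuple nat) f :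
    sat M (A n k) a -> sat M f (tup n k) -> sat M f a.
  have [j <- Aa fk] := tupK n a; apply: contrapT => nf.
  have [_] := svalP (cid (sep n (tup n k, tup n j)));
    by apply; [exists f|apply: Aa].
have [| | | | |G [mG GM /(_ _ GM) <-]//] :=
    @determined_orbit [set X | X M] A.
- by move=> X Y XY /XY.
- by move=> T X.
- move=> n k theta; have [H|H] := pselect (sat M theta (tup n k)).
    by left=> a _ /AP; apply.
  by right=> a _ Aa; apply: (AP _ _ _ (fNot theta) Aa H).
- move=> theta; have [H|H] := pselect (sat M theta [tuple]).
    by left=> a _ _; rewrite tuple0.
  by right=> a _ _; rewrite tuple0.
- move=> n a _; have [k <-] := tupK n a; exists k => j /=.
  by have [] := svalP (cid (sep n (tup n k, tup n j))).
Qed.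

Lemma act_image_invariant (X : set (Str L)) :
  (forall s M, bijective s -> X M -> X (act s M)) ->
  forall s, bijective s -> act s @` X = X.
Proof.
move=> actX s [t st ts]; apply/seteqP; split=> M.
  by move=> [N XN <-]; apply: actX => //; exists t.
by move=> XM; exists (act t M); [apply: actX => //; exists s|apply: act_cancel].
Qed.

Lemma orbit_act (M N : Str L) s : bijective s -> Defs.orbit M N ->
  Defs.orbit M (act s N).
Proof.
move=> bs [t bt ->]; exists (s \o t); first exact: bij_comp.
exact: act_comp.
Qed.

End Back_and_forth_systems.

(** * Atoms of the algebra of formulas *)

Local Open Scope ring_scope.

Lemma half_maximizer (R : realType) (Y : Type) (S : set Y) (v : Y -> R) :
  S !=set0 -> (forall y, 0 <= v y <= 1) ->
  exists2 y, S y & forall y', S y' -> v y' <= 2 * v y.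
Proof.
move=> [y0 Sy0] v01; have vS : has_sup (v @` S).
  by split; [exists (v y0), y0|exists 1 => _ [y _ <-]; have /andP[] := v01 y].
have le_sup y : S y -> v y <= sup (v @` S).
  by move=> Sy; apply: (sup_upper_bound vS); exists y.
have [s0|s0] := leP (sup (v @` S)) 0.
  by exists y0 => // y /le_sup; have := v01 y0; lra.
have [_ [y Sy <-] vy] := sup_adherent (divr_gt0 s0 (ltr0Sn R 1)) vS.
by exists y => // y' /le_sup; lra.
Qed.

Lemma no_uniform_descent (R : realType) (u : nat -> R) (d : R) :
  0 < d -> (forall k, 0 <= u k) -> ~ forall k, u k.+1 <= u k - d.
Proof.
move=> d0 u0 ud; have uk k : u k <= u 0%N - k%:R * d.
  elim: k => [|k IH]; first by rewrite mul0r subr0.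
  by apply: le_trans (ud k) _; rewrite -natr1 mulrDl; lra.
have := archi_boundP (divr_ge0 (u0 0%N) (ltW d0)).
rewrite ltr_pdivrMr // => ub.
by have := u0 (Num.bound (u 0%N / d)); have := uk (Num.bound (u 0%N / d)); lra.
Qed.

Section Invariant_measure.
Variables (R : realType) (L : language) (mu : probability (StrBorel L) R).

Definition prob n (f : iformula L n) : R := fine (mu_form mu f).

Lemma measurable_form n (f : iformula L n) :
  measurable ([set M | sat M f (std_tuple n)] : set (StrBorel L)).
Proof. exact: measurable_sat. Qed.

Lemma probE n (f : iformula L n) : mu_form mu f = (prob f)%:E.
Proof.
by rewrite /prob fineK// fin_num_measure//; apply: measurable_form.
Qed.

Lemma prob_ge0 n (f : iformula L n) : 0 <= prob f.
Proof. by apply: fine_ge0; apply: measure_ge0. Qed.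

Lemma prob_le1 n (f : iformula L n) : prob f <= 1.
Proof.
by rewrite -lee_fin -probE; apply: probability_le1; apply: measurable_form.
Qed.

Lemma le_prob n (f g : iformula L n) :
  (forall M : Str L, sat M f (std_tuple n) -> sat M g (std_tuple n)) ->
  prob f <= prob g.
Proof.
move=> fg; rewrite -lee_fin -!probE; apply: le_measure => //.
- by rewrite inE; apply: measurable_form.
- by rewrite inE; apply: measurable_form.
Qed.

Lemma prob_unsat n (f : iformula L n) :
  (forall M : Str L, ~ sat M f (std_tuple n)) -> prob f = 0.
Proof.
move=> nf; rewrite /prob /mu_form [X in mu X](_ : _ = set0) ?measure0 //.
by apply/seteqP; split=> // M /nf.
Qed.

Lemma prob_split n (f g : iformula L n) :
  prob f = prob (fAnd f g) + prob (fAnd f (fNot g)).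
Proof.
apply: EFin_inj; rewrite EFinD -!probE addeC.
exact: (measureDI mu (measurable_form f) (measurable_form g)).
Qed.

(** A formula is an atom if no formula splits it into two parts of positive
    measure.  Null formulas count as atoms; the positive ones are the atoms of
    the algebra of n-ary formulas modulo [mu]. *)
Definition atom n (psi : iformula L n) :=
  forall theta : iformula L n,
    prob (fAnd psi theta) = 0 \/ prob (fAnd psi (fNot theta)) = 0.

Definition evenness n (psi theta : iformula L n) : R :=
  Num.min (prob (fAnd psi theta)) (prob (fAnd psi (fNot theta))).

Lemma evenness_ge0 n (psi theta : iformula L n) : 0 <= evenness psi theta.
Proof. by rewrite le_min !prob_ge0. Qed.

Lemma le_evenness n (psi psi' theta : iformula L n) :
  (forall M : Str L, sat M psi (std_tuple n) -> sat M psi' (std_tuple n)) ->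
  evenness psi theta <= evenness psi' theta.
Proof.
move=> H; rewrite le_min; apply/andP; split; rewrite ge_min; apply/orP.
  by left; apply: le_prob => M /= [/H].
by right; apply: le_prob => M /= [/H].
Qed.

Lemma evenness_atom n (psi : iformula L n) :
  ~ atom psi -> exists theta, 0 < evenness psi theta.
Proof.
move=> /existsNP[theta /not_orP[t1 t2]]; exists theta.
by rewrite lt_min !lt0r !prob_ge0 !andbT; apply/andP; split; apply/eqP.
Qed.

Lemma measurable_conj n (p : set (iformula L n)) : countable p ->
  measurable ([set M | forall f, p f -> sat M f (std_tuple n)] :
    set (StrBorel L)).
Proof.
move=> /countable_injP[code codeI].
(* An intersection over codes in [nat] is a countable one. *)
rewrite [X in measurable X](_ : _ = [set M | forall k f, p f -> code f = k ->
    sat M f (std_tuple n)]); last first.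
  by apply/seteqP; split=> M /= H; [move=> k f pf _; exact: H|move=> f pf];
     exact: H pf erefl.
apply: measurable_forall => k.
have [[f [pf fk]]|nof] := pselect (exists f, p f /\ code f = k).
  rewrite [X in measurable X](_ : _ = [set M | sat M f (std_tuple n)]).
    exact: measurable_form.
  apply/seteqP; split=> M /= H; first exact: H fk.
  move=> g pg gk; rewrite (_ : g = f) //.
  by apply: codeI; rewrite ?inE // gk.
rewrite [X in measurable X](_ : _ = setT) //.
by apply/seteqP; split=> M //= _ f pf fk; case: nof; exists f.
Qed.

(** The negation of the condition of the theorem at the fragment [F]: in every
    countable fragment above [F], each formula of positive measure belongs to a
    type of positive measure. *)
Definition concentrated_above (F : formset L) :=
  forall F' : formset L, countable_fragment F' ->
  (forall n, F n `<=` F' n) ->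
  forall n (chi : iformula L n), F' n chi -> 0 < prob chi ->
  exists p, [/\ is_type F' p, p chi & mu_type mu p <> 0%E].

(** Suppose no atom of positive measure lies below [phi].  Split [phi] by a
    formula that is at least half as even as any other, split both halves in the
    same way, and so on; a countable fragment [F'] contains the binary tree so
    obtained.  An [F']-type [p] of positive measure containing [phi] selects a
    branch.  The conjunction of the branch has positive measure, so some formula
    splits it, with evenness d > 0; that formula splits every node of the branch
    with evenness at least d, so each step of the branch loses at least d / 2,
    which is absurd. *)
Lemma exists_atom (F : formset L) n (phi : iformula L n) :
  countable_fragment F -> concentrated_above F -> 0 < prob phi ->
  exists psi, [/\ 0 < prob psi, atom psi &
    forall M : Str L, sat M psi (std_tuple n) -> sat M phi (std_tuple n)].
Proof.
move=> cF concF phi0; apply: contrapT => natom.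
have ex_theta (psi : iformula L n) : exists theta, forall theta',
    evenness psi theta' <= 2 * evenness psi theta.
  have [| |theta _ H] := @half_maximizer R _ setT (evenness psi).
  - by exists (fTrue n).
  - by move=> y; rewrite evenness_ge0 /evenness ge_min prob_le1.
  - by exists theta => theta'; apply: H.
have [theta thetaP] := choice ex_theta.
pose side (f : iformula L n) (b : bool) :=
  if b then fAnd f (theta f) else fAnd f (fNot (theta f)).
pose node := fix node (s : seq bool) : iformula L n :=
  if s is b :: s' then side (node s') b else phi.
(* The transport [eq_rect] puts the tree at arity [n] in a family of sets
   indexed by all arities. *)
pose S m : set (iformula L m) :=
  F m `|` [set eq_rect n (iformula L) (node s) m e |
           e in [set: n = m] & s in [set: seq bool]].
have cS m : countable (S m).
  apply: countable_setU; first exact: (proj2 cF).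
  apply: countable_image2; last exact: countableP.
  apply/countable_injP; exists (fun=> 0%N) => e e' _ _ _.
  exact: eq_irrelevance.
have [F' [cF' SF']] := exists_countable_fragment cS.
have nodeF' s : F' n (node s).
  by apply: SF'; right; exists erefl => //; exists s.
have [p [[D [M [a [_ pE]]]] pphi pos]] :=
  concF F' cF' (fun m f Ff => SF' m f (or_introl Ff)) _ _ (nodeF' [::]) phi0.
(* The branch of the tree followed by the tuple that realizes [p]. *)
pose path := fix path k := if k is k'.+1 then
  let s := path k' in `[< sat M (theta (node s)) a >] :: s else [::].
pose chi k := node (path k).
have chi_p k : p (chi k).
  rewrite pE; split; first exact: nodeF'.
  rewrite /chi; elim: k => [|k IH]; first by move: pphi; rewrite pE => -[].
  by rewrite /= /side; case: asboolP.
pose psi := fBigAnd chi.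
have psi0 : 0 < prob psi.
  rewrite lt0r prob_ge0 andbT; apply/eqP => psi0; apply: pos.
  have mp : countable p.
    apply: sub_countable (proj2 cF' n); apply: subset_card_le.
    by rewrite pE => f [].
  have : (mu_type mu p <= mu_form mu psi)%E.
    apply: le_measure.
    - by rewrite inE; exact: measurable_conj.
    - by rewrite inE; exact: measurable_form.
    - by move=> N Np k; apply: Np; apply: chi_p.
  by rewrite probE psi0 measure_le0 => /eqP.
have [theta' even0] : exists theta', 0 < evenness psi theta'.
  apply: evenness_atom => atom_psi; apply: natom; exists psi; split=> // N.
  exact: (fun H => H 0%N).
apply: (@no_uniform_descent R (fun k => prob (chi k))
  (evenness psi theta' / 2)).
- by rewrite divr_gt0.
- by move=> k; apply: prob_ge0.
- move=> k; have : evenness psi theta' <= evenness (chi k) theta'.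
    by apply: le_evenness => N /= Npsi; exact: Npsi.
  have := thetaP (chi k) theta'; rewrite {2}/evenness.
  set f := fAnd _ _; set g := fAnd _ _.
  have : Num.min (prob f) (prob g) <= prob f by rewrite ge_min lexx.
  have : Num.min (prob f) (prob g) <= prob g by rewrite ge_min lexx orbT.
  have := prob_split (chi k) (theta (chi k)); rewrite -/f -/g.
  have [->|->] : chi k.+1 = f \/ chi k.+1 = g; [|lra|lra].
  by rewrite /f /g /chi /= /side; case: ifP => _; [left|right].
Qed.

(** Exhaustion: at each step remove from the remainder an atom which takes at
    least half as much of it as any other.  An atom of positive measure below
    the final remainder would have made every step lose at least half of its
    measure. *)
Lemma exists_atomic_cover (F : formset L) n :
  countable_fragment F -> concentrated_above F ->
  exists A : nat -> iformula L n,
  (forall k, atom (A k)) /\ prob (fBigAnd (fun k => fNot (A k))) = 0.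
Proof.
move=> cF concF; have ex_best (chi : iformula L n) : exists psi, atom psi /\
    forall psi', atom psi' -> prob (fAnd chi psi') <= 2 * prob (fAnd chi psi).
  have [| |psi apsi H] :=
      @half_maximizer R _ (@atom n) (fun f => prob (fAnd chi f)).
  - by exists (fFalse n) => theta; left; apply: prob_unsat => M [].
  - by move=> f; rewrite prob_ge0 prob_le1.
  - by exists psi.
have [best bestP] := choice ex_best.
pose chi := fix chi k : iformula L n :=
  if k is k'.+1 then fAnd (chi k') (fNot (best (chi k'))) else fTrue n.
exists (fun k => best (chi k)); split.
  by move=> k; apply: (proj1 (bestP _)).
set rest := fBigAnd _.
have rest_chi (M : Str L) k :
    sat M rest (std_tuple n) -> sat M (chi k) (std_tuple n).
  by move=> Mr; elim: k => //= k IH; split=> //; exact: Mr k.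
apply/eqP; apply: contrapT => /negP rest0.
have {rest0} rest0 : 0 < prob rest by rewrite lt0r prob_ge0 rest0.
have [psi [psi0 apsi psi_rest]] := exists_atom cF concF rest0.
apply: (@no_uniform_descent R (fun k => prob (chi k)) (prob psi / 2)).
- by rewrite divr_gt0.
- by move=> k; apply: prob_ge0.
- move=> k; have := proj2 (bestP (chi k)) _ apsi.
  have : prob psi <= prob (fAnd (chi k) psi).
    by apply: le_prob => M Mpsi; split=> //; apply/rest_chi/psi_rest.
  by have := prob_split (chi k) (best (chi k)); rewrite /=; lra.
Qed.

Lemma prob_eq0 n (f : iformula L n) : Defs.invariant mu -> prob f = 0 ->
  forall a : n.-tuple nat, uniq a -> mu [set M | sat M f a] = 0%E.
Proof. by move=> imu f0 a ua; rewrite mu_formE// probE f0. Qed.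

(** * The two directions *)

Definition almost_all (X : set (Str L)) :=
  negligible mu (~` X : set (StrBorel L)).

Lemma almost_allS (X Y : set (Str L)) :
  X `<=` Y -> almost_all X -> almost_all Y.
Proof.
by move=> XY [Z [mZ Z0 XZ]]; exists Z; split=> // M nY; apply: XZ => /XY.
Qed.

Lemma almost_all_forall (T : countType) (X : T -> set (Str L)) :
  (forall t, almost_all (X t)) -> almost_all [set M | forall t, X t M].
Proof.
move=> aX; pose Z k : set (StrBorel L) :=
  if unpickle k is Some t then ~` X t else set0.
have : negligible mu (\bigcup_k Z k).
  apply: negligible_bigcup => k; rewrite /Z; case: unpickle => [t|].
    exact: aX.
  exact: negligible_set0.
case=> Y [mY Y0 ZY]; exists Y; split=> // M /existsNP[t nX].
by apply: ZY; exists (pickle t) => //; rewrite /Z pickleK.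
Qed.

Lemma almost_all_not n (f : iformula L n) : Defs.invariant mu -> prob f = 0 ->
  almost_all [set M | forall a : n.-tuple nat, uniq a -> ~ sat M f a].
Proof.
move=> imu f0; apply: almost_all_forall => a.
have [ua|nua] := pselect (uniq a); last first.
  by exists set0; split=> // M; apply.
exists [set M | sat M f a]; split; first exact: measurable_sat.
  exact: prob_eq0.
by move=> M /= /not_implyP[_ /contrapT].
Qed.

Lemma atom_determined n (psi : iformula L n) : Defs.invariant mu -> atom psi ->
  determined almost_all psi.
Proof.
move=> imu apsi theta; have [H|H] := apsi theta; [right|left].
  apply: almost_allS (almost_all_not imu H) => M /= H1 a ua pa ta.
  exact: (H1 a ua).
apply: almost_allS (almost_all_not imu H) => M /= H1 a ua pa.
by apply: contrapT => nta; exact: (H1 a ua).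
Qed.

Lemma ergodic01 (X : set (Str L)) : ergodic mu ->
  measurable (X : set (StrBorel L)) ->
  (forall s M, bijective s -> X M -> X (act s M)) ->
  mu X = 0%E \/ mu X = 1%E.
Proof.
move=> emu mX actX; apply: emu => // s bs.
by rewrite act_image_invariant // setYK measure0.
Qed.

(** The set of models of a sentence is isomorphism invariant, hence has measure
    0 or 1. *)
Lemma sentence_atom (psi : iformula L 0) : ergodic mu -> atom psi.
Proof.
move=> emu theta; have psi_theta := prob_split psi theta.
have tuple_act s (M : Str L) (f : iformula L 0) :
    bijective s -> sat M f (std_tuple 0) -> sat (act s M) f (std_tuple 0).
  move=> bs /(proj2 (@sat_act _ s M _ f (std_tuple 0) bs)).
  by rewrite (tuple0 (map_tuple s _)) (tuple0 (std_tuple 0)).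
have [E|E] := ergodic01 emu (measurable_form (fAnd psi theta))
  (fun s M bs => @tuple_act s M _ bs).
  by left; rewrite /prob /mu_form E.
right; apply/eqP; rewrite eq_le prob_ge0 andbT.
have : prob (fAnd psi theta) = 1 by rewrite /prob /mu_form E.
by have := prob_le1 psi; lra.
Qed.

(** Atoms are complete modulo the null sets, so a cover by atoms satisfies the
    hypotheses of [determined_orbit]. *)
Lemma exists_orbit_of_measure1 : Defs.invariant mu -> ergodic mu ->
  (forall n, exists A : nat -> iformula L n,
    (forall k, atom (A k)) /\ prob (fBigAnd (fun k => fNot (A k))) = 0) ->
  exists M, mu (Defs.orbit M) = 1%E.
Proof.
move=> imu emu covers.
pose A n := sval (cid (covers n)); have AP n := svalP (cid (covers n)).
have [| | | | |G [mG aG orbG]] := @determined_orbit L almost_all A.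
- exact: almost_allS.
- exact: almost_all_forall.
- by move=> n k; apply: atom_determined => //; exact: (proj1 (AP n) k).
- by apply: atom_determined => //; apply: sentence_atom.
- move=> n; have [_ A0] := AP n.
  apply: almost_allS (almost_all_not imu A0) => M /= H a ua.
  apply: contrapT => /forallNP nA; exact: (H a ua nA).
have G1 : mu G = 1%E.
  have G0 : mu (~` G) = 0%E by apply/negligibleP => //; apply: measurableC.
  by rewrite -[G]setCK probability_setC ?G0 ?sube0 //; apply: measurableC.
have [M GM] : G !=set0.
  apply/set0P/eqP => G0; move: G1; rewrite G0 measure0 => /eqP.
  by rewrite eqe eq_sym oner_eq0.
by exists M; rewrite -(orbG M GM).
Qed.

(** If [mu] lives on the isomorphism class of [M], then the standard tuple
    almost surely realizes the type of a tuple of [M], and there are only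
    countably many of these. *)
Lemma positive_type_of_orbit (M : Str L) (F : formset L) n
    (chi : iformula L n) :
  mu (Defs.orbit M) = 1%E -> countable_fragment F -> F n chi ->
  0 < prob chi ->
  exists p, [/\ is_type F p, p chi & mu_type mu p <> 0%E].
Proof.
move=> M1 cF Fchi chi0; apply: contrapT => none.
pose p (b : n.-tuple nat) := [set f | F n f /\ sat M f b].
have tp b : is_type F (p b) by exists nat, M, b; split.
have p0 b : sat M chi b -> mu_type mu (p b) = 0%E.
  move=> Mb; apply: contrapT => nz; apply: none.
  by exists (p b); split.
pose real (b : n.-tuple nat) : set (Str L) :=
  [set N | forall f, p b f -> sat N f (std_tuple n)].
have mreal b : measurable (real b : set (StrBorel L)).
  by apply: measurable_conj; apply: sub_countable (proj2 cF n);
     apply: subset_card_le => f [].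
have none_real : almost_all [set N | forall b, sat M chi b -> ~ real b N].
  apply: almost_all_forall => b.
  have [Mb|nMb] := pselect (sat M chi b); last first.
    by exists set0; split=> // N; apply.
  exists (real b); split=> //; first exact: p0.
  by move=> N /= /not_implyP[_ /contrapT].
have orb : almost_all (Defs.orbit M).
  have mC := measurableC (measurable_orbit M).
  exists (~` Defs.orbit M); split=> //.
  by rewrite probability_setC ?M1 ?subee //; apply: measurable_orbit.
have : mu [set N | sat N chi (std_tuple n)] = 0%E.
  apply/negligibleP; first exact: measurable_form.
  have : almost_all [set N | forall b : bool, (if b then Defs.orbit M else
      [set N | forall b, sat M chi b -> ~ real b N]) N].
    by apply: almost_all_forall => -[].
  apply: negligibleS => N Nchi H; have [s [t st ts] NE] := H true.
  have sE : std_tuple n = map_tuple s (map_tuple t (std_tuple n)).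
    by apply: eq_from_tnth => i; rewrite !tnth_map ts.
  have bs : bijective s by exists t.
  apply: (H false (map_tuple t (std_tuple n))).
    by apply/(@sat_act _ s) => //; rewrite -sE -NE.
  by move=> f [_ Mf]; rewrite sE NE; apply/sat_act.
by move: chi0; rewrite -lte_fin -probE => /[swap] E; rewrite /mu_form E ltxx.
Qed.

End Invariant_measure.

Local Open Scope ereal_scope.

Theorem theorem4p7 (R : realType) (L : language)
    (mu : probability (StrBorel L) R) (hmu : ergodic_structure mu) :
  properly_ergodic mu <->
  (forall F : formset L, countable_fragment F ->
    exists F' : formset L,
      [/\ countable_fragment F', (forall n, F n `<=` F' n) &
          exists (n : nat) (chi : iformula L n),
            [/\ F' n chi, 0 < mu_form mu chi &
                forall p : set (iformula L n),
                  is_type F' p -> p chi -> mu_type mu p = 0]]).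
Proof.
have [imu emu] := hmu; split=> [[_ orb0] F cF|H].
  apply: contrapT => nF'; have concF : concentrated_above mu F.
    move=> F' cF' FF' n chi F'chi chi0; apply: contrapT => nop.
    apply: nF'; exists F'; split=> //; exists n, chi; split=> //.
      by rewrite probE lte_fin.
    move=> p tp pchi; apply: contrapT => p0; apply: nop.
    by exists p; split.
  have [|M] := exists_orbit_of_measure1 imu emu.
    by move=> n; apply: exists_atomic_cover cF concF.
  by rewrite orb0 => /eqP; rewrite eqe eq_sym oner_eq0.
split=> // M.
have [//|M1] := ergodic01 emu (measurable_orbit M)
  (fun s N => @orbit_act L M N s).
have [F [cF _]] :=
  @exists_countable_fragment L (fun=> set0) (fun=> countable0 _).
have [F' [cF' _ [n [chi [F'chi chi0 chi_null]]]]] := H F cF.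
rewrite probE lte_fin in chi0.
have [p [tp pchi]] := positive_type_of_orbit M1 cF' F'chi chi0.
by rewrite chi_null.
Qed.
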